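(* Let $Q$ be the $5\times 5$ permutation matrix whose $1$ entries are exactly at positions (row, column) $(1,2),(2,5),(3,3),(4,1),(5,4)$. Then $sat(Q,n)<400$ for every positive integer $n$.
   Context: All matrices are $0$-$1$ matrices; an $m\times n$ matrix has $m$ rows and $n$ columns. The weight of a matrix is its number of $1$ entries. A matrix $M$ contains a $k\times l$ pattern $P$ if there are rows $r_1<\dots<r_k$ and columns $c_1<\dots<c_l$ of $M$ such that $M(r_a,c_b)=1$ whenever $P(a,b)=1$; otherwise $M$ avoids $P$. A matrix $M$ is saturating for $P$ if $M$ avoids $P$ and changing any single $0$ entry of $M$ to $1$ yields a matrix containing $P$. $sat(P,m,n)$ is the minimum weight of an $m\times n$ matrix saturating for $P$, and $sat(P,n)=sat(P,n,n)$. *)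

(* Defs.v *)
From mathcomp Require Import all_boot all_order all_algebra.

Set Implicit Arguments.
Unset Strict Implicit.
Unset Printing Implicit Defensive.

(* 0-1 matrices are matrices over bool; indices are 0-based. *)

Definition weight m n (M : 'M[bool]_(m, n)) : nat :=
  #|[set ij : 'I_m * 'I_n | M ij.1 ij.2]|.

Definition increasing k m (f : {ffun 'I_k -> 'I_m}) : bool :=
  [forall a : 'I_k, forall b : 'I_k, (a < b) ==> (f a < f b)].

Definition contains k l m n (P : 'M[bool]_(k, l)) (M : 'M[bool]_(m, n)) : bool :=
  [exists r : {ffun 'I_k -> 'I_m}, exists c : {ffun 'I_l -> 'I_n},
     [&& increasing r, increasing c &
         [forall a : 'I_k, forall b : 'I_l, P a b ==> M (r a) (c b)]]].

Definition avoids k l m n (P : 'M[bool]_(k, l)) (M : 'M[bool]_(m, n)) : bool :=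
  ~~ contains P M.

Definition set_entry m n (M : 'M[bool]_(m, n)) (i : 'I_m) (j : 'I_n) :
    'M[bool]_(m, n) :=
  \matrix_(a, b) (((a == i) && (b == j)) || M a b).

Definition saturating k l m n (P : 'M[bool]_(k, l)) (M : 'M[bool]_(m, n)) : bool :=
  avoids P M &&
  [forall i : 'I_m, forall j : 'I_n, ~~ M i j ==> contains P (set_entry M i j)].

(* The default (m * n).+1 exceeds the weight of every m x n matrix, so it is
   the value only when no saturating matrix exists. By [saturating_exists]
   this does not happen when P has a 1 entry; then [sat_minimum] applies. *)
Definition sat k l (P : 'M[bool]_(k, l)) (m n : nat) : nat :=
  \big[minn/(m * n).+1]_(M : 'M[bool]_(m, n) | saturating P M) weight M.

Definition Q : 'M[bool]_(5, 5) :=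
  \matrix_(i < 5, j < 5)
    ((i.+1, j.+1) \in [:: (1, 2); (2, 5); (3, 3); (4, 1); (5, 4)]).

Lemma weight_le m n (M : 'M[bool]_(m, n)) : weight M <= m * n.
Proof. by rewrite (leq_trans (max_card _)) // card_prod !card_ord. Qed.

Lemma sat_minimum k l (P : 'M[bool]_(k, l)) m n :
  (exists M : 'M[bool]_(m, n), saturating P M) ->
  (exists2 M : 'M[bool]_(m, n), saturating P M & weight M = sat P m n) /\
  (forall M : 'M[bool]_(m, n), saturating P M -> sat P m n <= weight M).
Proof.
have lb (M : 'M[bool]_(m, n)) : saturating P M -> sat P m n <= weight M.
  move=> sM; rewrite /sat; have: M \in index_enum _ by rewrite mem_index_enum.
  elim: (index_enum _) => // N s IHs; rewrite inE big_cons => /orP[/eqP<-|Ms].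
    by rewrite sM geq_minl.
  by case: ifP => _; rewrite ?geq_min IHs ?orbT.
move=> [M0 sM0]; split=> //.
have : sat P m n = (m * n).+1 \/
       exists2 M : 'M[bool]_(m, n), saturating P M & weight M = sat P m n.
  rewrite /sat; apply: (big_ind (fun s => s = (m * n).+1 \/
    exists2 M : 'M[bool]_(m, n), saturating P M & weight M = s)).
  - by left.
  - by move=> x y Hx Hy; rewrite /minn; case: ifP.
  - by move=> M sM; right; exists M.
case=> // e; have := leq_trans (lb _ sM0) (weight_le M0).
by rewrite e ltnn.
Qed.

Lemma saturating_exists k l (P : 'M[bool]_(k, l)) m n :
  (exists a b, P a b) -> exists M : 'M[bool]_(m, n), saturating P M.
Proof.
move=> [a [b Pab]].
have av0 : avoids P (const_mx false : 'M[bool]_(m, n)).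
  apply/negP=> /existsP[r /existsP[c /and3P[_ _ /forallP/(_ a)/forallP/(_ b)]]].
  by rewrite Pab mxE.
case: (@arg_maxnP _ (const_mx false : 'M[bool]_(m, n)) (avoids P) (@weight m n) av0).
move=> M avM maxM; exists M; rewrite /saturating avM /=.
apply/forallP=> i; apply/forallP=> j; apply/implyP=> Mij.
case: (boolP (contains P (set_entry M i j))) => // avM'; have := maxM _ avM'.
rewrite /geq /= leqNgt => /negP; case; apply: proper_card; apply/properP; split.
  by apply/subsetP=> x; rewrite !inE mxE => ->; rewrite orbT.
by exists (i, j); rewrite !inE ?mxE ?eqxx //= (negbTE Mij).
Qed.

(* Main.v *)
Require Import Defs.
From mathcomp Require Import all_boot all_order all_algebra.
From mathcomp Require Import zify.

Set Implicit Arguments.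
Unset Strict Implicit.
Unset Printing Implicit Defensive.

(** Let [W] be a fixed matrix avoiding a pattern [P] without zero rows or
    columns, such that setting any entry of row [e] or column [f] to 1 creates a
    copy of [P]; in particular row [e] and column [f] are zero.  Replacing that
    row and that column by arbitrarily many copies of themselves preserves both
    properties.  Extend the resulting matrix to a maximal one avoiding [P]: it is
    saturating, and all its 1 entries lie outside the duplicated rows and columns,
    so its weight is bounded in terms of the dimensions of [W] only.  For [Q] a
    9 x 9 matrix [W] with twelve 1 entries does the job. *)

Lemma containsP k l m n (P : 'M[bool]_(k, l)) (M : 'M[bool]_(m, n)) :
  reflect (exists (r : 'I_k -> 'I_m) (c : 'I_l -> 'I_n),
             [/\ {homo r : a b / a < b}, {homo c : a b / a < b} &
                 forall a b, P a b -> M (r a) (c b)])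
          (contains P M).
Proof.
apply: (iffP existsP) => [[r /existsP[c /and3P[incr incc PM]]]|[r [c [incr incc PM]]]].
  exists r, c; split=> a b.
  - by move/forallP/(_ a)/forallP/(_ b)/implyP: incr; apply.
  - by move/forallP/(_ a)/forallP/(_ b)/implyP: incc; apply.
  - by move/forallP/(_ a)/forallP/(_ b)/implyP: PM; apply.
exists (finfun r); apply/existsP; exists (finfun c); apply/and3P; split;
  apply/forallP=> a; apply/forallP=> b; apply/implyP; rewrite !ffunE.
- exact: incr.
- exact: incc.
- exact: PM.
Qed.

Definition submatrix m n (M N : 'M[bool]_(m, n)) : Prop :=
  forall i j, M i j -> N i j.

Lemma contains_submatrix k l m n (P : 'M[bool]_(k, l)) (M N : 'M[bool]_(m, n)) :
  submatrix M N -> contains P M -> contains P N.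
Proof.
move=> MN /containsP[r [c [incr incc PM]]]; apply/containsP.
by exists r, c; split=> // a b /PM /MN.
Qed.

(** Take [M] of maximal weight among the matrices above [N] that avoid [P]: one more 1 still
    avoiding [P] would contradict maximality. *)
Lemma avoids_extend_saturating k l m n (P : 'M[bool]_(k, l))
    (N : 'M[bool]_(m, n)) :
  avoids P N -> exists2 M : 'M[bool]_(m, n), saturating P M & submatrix N M.
Proof.
move=> avN.
pose above (M : 'M[bool]_(m, n)) :=
  avoids P M && [forall i, forall j, N i j ==> M i j].
have aboveN : above N.
  by rewrite /above avN; apply/forallP=> i; apply/forallP=> j; apply/implyP.
case: (@arg_maxnP _ N above (@weight m n) aboveN) => M /andP[avM NM] maxM.
have {}NM : submatrix N M.
  by move=> i j; move/forallP/(_ i)/forallP/(_ j)/implyP: NM; apply.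
exists M => //; rewrite /saturating avM /=.
apply/forallP=> i; apply/forallP=> j; apply/implyP=> Mij.
apply: contraT => avM'.
have aboveM' : above (set_entry M i j).
  rewrite /above [avoids _ _]avM'; apply/forallP=> a; apply/forallP=> b.
  by apply/implyP=> /NM; rewrite mxE => ->; rewrite orbT.
have := maxM _ aboveM'; rewrite /geq /= leqNgt => /negP; case.
apply: proper_card; apply/properP; split.
  by apply/subsetP=> x; rewrite !inE mxE => ->; rewrite orbT.
by exists (i, j); rewrite !inE ?mxE ?eqxx //= (negbTE Mij).
Qed.

(* The monotone surjection from [0, n) to [0, p) that sends the n - p + 1
   consecutive integers starting at e to e and is injective elsewhere. *)
Definition collapse p n (e : 'I_p) (i : 'I_n) : 'I_p :=
  insubd e (if i < e then i : nat else maxn e (i - (n - p))).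

Section Collapse.

Variables (p n : nat) (le_pn : p <= n) (e : 'I_p).

(** With [p <= n] the value lies below [p], so the default of [insubd] never interferes. *)
Lemma val_collapse (i : 'I_n) :
  collapse e i = (if i < e then i : nat else maxn e (i - (n - p))) :> nat.
Proof.
rewrite /collapse val_insubd; have := ltn_ord i; have := ltn_ord e.
by case: ifP => //; case: ifP; lia.
Qed.

Lemma collapse_inj (i j : 'I_n) :
  collapse e i != e -> collapse e i = collapse e j -> i = j.
Proof.
rewrite -!val_eqE /= => nei /(congr1 val) /= eij; apply: val_inj => /=.
by move: nei eij; rewrite !val_collapse; do ?case: ifP => ?; lia.
Qed.

Lemma collapse_homo (i j : 'I_n) :
  collapse e i != e -> collapse e j != e -> i < j ->
  collapse e i < collapse e j.
Proof. by rewrite -!val_eqE /= !val_collapse; do ?case: ifP => ?; lia. Qed.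

(** Making the section pass through a prescribed [i] allows a copy of [P] to be lifted onto a chosen
    entry. *)
Lemma collapse_section (i : 'I_n) :
  exists s : 'I_p -> 'I_n, [/\ {homo s : a b / a < b},
    cancel s (collapse e) & s (collapse e i) = i].
Proof.
(* Away from [e] the preimage is forced; over [e] take [i] if it lies in that fibre, and otherwise
   the first element [e] of the fibre. *)
pose t (a : nat) : nat := if a < e then a else if e < a then a + (n - p)
  else if collapse e i == e then i : nat else e : nat.
have tP (a : 'I_p) : t a < n.
  rewrite /t; have := ltn_ord a; have := ltn_ord i; have := ltn_ord e.
  by do ?case: ifP => ?; lia.
have ci : collapse e i == e -> (e <= i) && (i <= e + (n - p)).
  by rewrite -val_eqE /= val_collapse; case: ifP; lia.
exists (fun a => Ordinal (tP a)); split=> [a b|a|].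
- rewrite /= /t => lt_ab; move: ci; case: (collapse e i == e) => [/(_ isT)|_];
    by do ?case: ifP => ?; lia.
- apply: val_inj; rewrite /= val_collapse /= /t.
  move: ci; case: (collapse e i == e) => [/(_ isT)|_];
    by case: (ltngtP a e) => ?; case: ifP; lia.
- apply: val_inj; rewrite /= /t.
  case: eqP => [->|/eqP]; first by rewrite ltnn.
  by rewrite -val_eqE /= !val_collapse; have := ltn_ord i; do ?case: ifP => ?; lia.
Qed.

Lemma card_collapse_neq : #|[set i : 'I_n | collapse e i != e]| <= p.-1.
Proof.
rewrite -(@card_in_imset _ _ (@collapse p n e)); last first.
  by move=> i j; rewrite inE => nei _; apply: collapse_inj.
have := cardsC1 e; rewrite card_ord => <-.
apply: subset_leq_card; apply/subsetP=> _ /imsetP[i + ->].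
by rewrite !inE.
Qed.

End Collapse.

Definition inflate p q m n (e : 'I_p) (f : 'I_q) (W : 'M[bool]_(p, q)) :
    'M[bool]_(m, n) :=
  \matrix_(i, j) W (collapse e i) (collapse f j).

(** Each row and column of a copy of [P] holds a 1, so the copy misses the duplicated zero lines,
    and [collapse] is strictly increasing on the others. *)
Lemma contains_inflate k l p q m n (P : 'M[bool]_(k, l)) (W : 'M[bool]_(p, q))
    (e : 'I_p) (f : 'I_q) :
  (forall a, exists b, P a b) -> (forall b, exists a, P a b) ->
  (forall i j, W i j -> (i != e) && (j != f)) -> p <= m -> q <= n ->
  contains P (inflate m n e f W) -> contains P W.
Proof.
move=> rowP colP W0 le_pm le_qn /containsP[r [c [incr incc PN]]].
have rne a : collapse e (r a) != e.
  by have [b /PN] := rowP a; rewrite mxE => /W0/andP[].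
have cne b : collapse f (c b) != f.
  by have [a /PN] := colP b; rewrite mxE => /W0/andP[].
apply/containsP; exists (collapse e \o r), (collapse f \o c); split=> a b /=.
- by move=> /incr; apply: collapse_homo.
- by move=> /incc; apply: collapse_homo.
- by move=> /PN; rewrite mxE.
Qed.

Lemma contains_set_entry_inflate k l p q m n (P : 'M[bool]_(k, l))
    (W : 'M[bool]_(p, q)) (e : 'I_p) (f : 'I_q) (i : 'I_m) (j : 'I_n) :
  p <= m -> q <= n -> contains P (set_entry W (collapse e i) (collapse f j)) ->
  contains P (set_entry (inflate m n e f W) i j).
Proof.
move=> le_pm le_qn /containsP[r [c [incr incc PW]]].
have [s [incs sK si]] := collapse_section le_pm e i.
have [t [inct tK tj]] := collapse_section le_qn f j.
apply/containsP; exists (s \o r), (t \o c); split=> a b /=.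
- by move=> /incr /incs.
- by move=> /incc /inct.
- by move=> /PW; rewrite !mxE sK tK => /orP[/andP[/eqP-> /eqP->]|->];
    rewrite ?orbT // si tj !eqxx.
Qed.

Lemma sat_le_of_witness k l p q m n (P : 'M[bool]_(k, l))
    (W : 'M[bool]_(p, q)) (e : 'I_p) (f : 'I_q) :
  (forall a, exists b, P a b) -> (forall b, exists a, P a b) -> avoids P W ->
  (forall i j, (i == e) || (j == f) -> contains P (set_entry W i j)) ->
  p <= m -> q <= n -> sat P m n <= p.-1 * q.-1.
Proof.
move=> rowP colP avW satW le_pm le_qn.
(* Setting an entry that is already 1 changes nothing, so a 1 on the cross would put [P] into
   [W]. *)
have W0 i j : W i j -> (i != e) && (j != f).
  move=> Wij; rewrite -negb_or; apply: contra avW => /satW.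
  by apply: contains_submatrix => a b; rewrite mxE => /orP[/andP[/eqP-> /eqP->]|].
have avN : avoids P (inflate m n e f W).
  exact: contra (contains_inflate rowP colP W0 le_pm le_qn) avW.
have [M satM NM] := avoids_extend_saturating avN.
have [_ /(_ M satM) le_sat] := sat_minimum (ex_intro _ M satM).
apply: leq_trans le_sat _.
have /leq_mul/(_ (card_collapse_neq le_qn f)) := card_collapse_neq le_pm e.
apply: leq_trans; rewrite -cardsX; apply: subset_leq_card.
(* If [M] had a 1 in a duplicated line, it would contain the inflation with that entry set, hence
   [P]. *)
apply/subsetP=> -[i j]; rewrite !inE /= => Mij; rewrite -negb_or.
have /andP[avM _] := satM; apply: contra avM => /satW.
move=> /(contains_set_entry_inflate le_pm le_qn).
apply: contains_submatrix => a b; rewrite mxE => /orP[/andP[/eqP-> /eqP->]//|].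
exact: NM.
Qed.

Definition ones_mx p q (s : seq (nat * nat)) : 'M[bool]_(p, q) :=
  \matrix_(i, j) ((i : nat, j : nat) \in s).

Lemma set_entry_ones_mx p q s (i : 'I_p) (j : 'I_q) :
  set_entry (ones_mx p q s) i j = ones_mx p q ((i : nat, j : nat) :: s).
Proof. by apply/matrixP=> a b; rewrite !mxE inE xpair_eqE. Qed.

(** A search that evaluates on concrete lists: [A] to [E] are the 1 entries by increasing row, with
    column order [D], [A], [C], [E], [B]. *)
Definition occursQ (s : seq (nat * nat)) : bool :=
  has (fun A => has (fun B => (A.1 < B.1) && (A.2 < B.2) &&
    has (fun C => [&& B.1 < C.1, A.2 < C.2 & C.2 < B.2] &&
      has (fun D => (C.1 < D.1) && (D.2 < A.2) &&
        has (fun E => [&& D.1 < E.1, C.2 < E.2 & E.2 < B.2]) s) s) s) s) s.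

Lemma occursQP p q s :
  all (fun x => (x.1 < p) && (x.2 < q)) s ->
  contains Q (ones_mx p q s) = occursQ s.
Proof.
move=> /allP s_pq; apply/containsP/idP => [[r [c [incr incc QM]]]|].
  have Qs (a b : 'I_5) : Q a b -> (r a : nat, c b : nat) \in s.
    by move/QM; rewrite mxE.
  pose i0 := @Ordinal 5 0 isT; pose i1 := @Ordinal 5 1 isT.
  pose i2 := @Ordinal 5 2 isT; pose i3 := @Ordinal 5 3 isT.
  pose i4 := @Ordinal 5 4 isT.
  apply/hasP; exists (r i0 : nat, c i1 : nat); first by apply: Qs; rewrite mxE.
  apply/hasP; exists (r i1 : nat, c i4 : nat); first by apply: Qs; rewrite mxE.
  rewrite /= incr ?incc //=.
  apply/hasP; exists (r i2 : nat, c i2 : nat); first by apply: Qs; rewrite mxE.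
  rewrite /= incr ?incc //=.
  apply/hasP; exists (r i3 : nat, c i0 : nat); first by apply: Qs; rewrite mxE.
  rewrite /= incr ?incc //=.
  apply/hasP; exists (r i4 : nat, c i3 : nat); first by apply: Qs; rewrite mxE.
  by rewrite /= incr ?incc.
case/hasP=> -[a a'] As /hasP[[b b'] Bs] /andP[/= AB].
case/hasP=> -[c c'] Cs /andP[/= BC] /hasP[[d d'] Ds] /andP[/= CD].
case/hasP=> -[x x'] Es /= DE.
have /andP[/= ap aq] := s_pq _ As; have /andP[/= bp bq] := s_pq _ Bs.
have /andP[/= cp cq] := s_pq _ Cs; have /andP[/= dp dq] := s_pq _ Ds.
have /andP[/= xp xq] := s_pq _ Es.
exists (fun k : 'I_5 => nth (Ordinal ap) [:: Ordinal ap; Ordinal bp; Ordinal cp;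
  Ordinal dp; Ordinal xp] k).
exists (fun k : 'I_5 => nth (Ordinal dq) [:: Ordinal dq; Ordinal aq; Ordinal cq;
  Ordinal xq; Ordinal bq] k).
split.
- by case=> [[|[|[|[|[|?]]]]] ?] //; case=> [[|[|[|[|[|?]]]]] ?] //= _; lia.
- by case=> [[|[|[|[|[|?]]]]] ?] //; case=> [[|[|[|[|[|?]]]]] ?] //= _; lia.
- by case=> [[|[|[|[|[|?]]]]] ?] //; case=> [[|[|[|[|[|?]]]]] ?] //=;
    rewrite !mxE.
Qed.

(* Row 4 and column 4 are zero; like Q itself, the matrix is invariant under a
   quarter turn. It was found by computer search. *)
Definition witness : seq (nat * nat) :=
  [:: (0, 2); (1, 5); (2, 3); (2, 8); (3, 1); (3, 6);
      (5, 2); (5, 7); (6, 0); (6, 5); (7, 3); (8, 6)].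

Lemma witness_saturated_cross (i j : 'I_9) :
  (i == inord 4) || (j == inord 4) ->
  contains Q (set_entry (ones_mx 9 9 witness) i j).
Proof.
rewrite set_entry_ones_mx occursQP ?[all _ (_ :: _)]/= ?ltn_ord //.
rewrite -!val_eqE /= !inordK // => cross.
(* Nine values of [x] cover the whole cross, so a finite computation suffices. *)
pose occ x := occursQ ((4, x) :: witness) && occursQ ((x, 4) :: witness).
have occP (k : 'I_9) : occ k.
  have /allP-> // : all occ (iota 0 9) by vm_compute.
  by rewrite mem_iota ltn_ord.
by case/orP: cross => /eqP->; [have /andP[] := occP j | have /andP[] := occP i].
Qed.

Theorem theorem3 (n : nat) (hn : 0 < n) : sat Q n n < 400.
Proof.
have rowQ a : exists b, Q a b.
  exists (tnth [tuple inord 1; inord 4; inord 2; inord 0; inord 3] a).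
  by case: a => [[|[|[|[|[|?]]]]] ?] //; rewrite mxE (tnth_nth ord0) /= inordK.
have colQ b : exists a, Q a b.
  exists (tnth [tuple inord 3; inord 0; inord 2; inord 4; inord 1] b).
  by case: b => [[|[|[|[|[|?]]]]] ?] //; rewrite mxE (tnth_nth ord0) /= inordK.
(* Inflation needs [9 <= n] and gives at most 64; for smaller [n] the whole matrix has at most 64
   entries. *)
have [n_ge9|n_lt9] := leqP 9 n.
  apply: (@leq_ltn_trans (9.-1 * 9.-1)) => //.
  apply: (sat_le_of_witness rowQ colQ _ witness_saturated_cross n_ge9 n_ge9).
  by rewrite /avoids occursQP //; vm_compute.
have [|[M _ <-] _] := @sat_minimum _ _ Q n n.
  by apply: saturating_exists; exists ord0; apply: rowQ.
by apply: leq_ltn_trans (weight_le M) _; nia.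
Qed.
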